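(* Let $C=C_1\cup\dots\cup C_n$ be a lattice-like bouquet. Then for every $k\in\mathbb{N}$, every proper $k$-colouring of $\mathbb{R}^2$ contains a smiling congruent copy of $C$.
   Context: A bouquet through $O$ is a union $C_1\cup\dots\cup C_n$ of unit circles all passing through $O$; let $O_i$ be the centre of $C_i$. A lattice $\mathcal{L}=\{n_1v_1+n_2v_2:n_1,n_2\in\mathbb{Z}\}$ ($v_1,v_2$ linearly independent) is rotatable if for every $0\le\alpha_1<\alpha_2\le\pi$ there are $\alpha\in(\alpha_1,\alpha_2)$ and $\lambda>0$ with $\lambda\rho_\alpha(\mathcal{L})\subseteq\mathcal{L}$, $\rho_\alpha$ the rotation by $\alpha$ about the origin. The bouquet is lattice-like if $O\notin\operatorname{conv}\{O_1,\dots,O_n\}$ and there is a rotatable lattice $\mathcal{L}$ with $\{O,O_1,\dots,O_n\}\subseteq\mathcal{L}$. A proper $k$-colouring of $\mathbb{R}^2$ is $\varphi:\mathbb{R}^2\to[k]$ with $\varphi(p)\ne\varphi(q)$ whenever $\|p-q\|=1$. A congruent copy of $C$ is its image under a plane isometry; a bouquet through $O$ is smiling if some colour appears on every circle $C_i$ but not at $O$. *)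

(* Defs.v *)
From HB Require Import structures.
From mathcomp Require Export all_boot all_order all_algebra.
From mathcomp Require Export all_classical all_reals all_analysis.

Set Implicit Arguments.
Unset Strict Implicit.
Unset Printing Implicit Defensive.
Import Order.TTheory GRing.Theory Num.Theory.

Local Open Scope classical_set_scope.
Local Open Scope ring_scope.

Notation plane R := 'rV[R]_2.

(* The norm `|_| that the library puts on 'rV[R]_2 is the sup norm, hence a
   separate Euclidean distance. *)
Definition edist (R : realType) (p q : plane R) : R :=
  Num.sqrt (\sum_(j < 2) (p 0 j - q 0 j) ^+ 2).

Definition plane_isometry (R : realType) (f : plane R -> plane R) : Prop :=
  forall p q, edist (f p) (f q) = edist p q.

Definition rotation (R : realType) (a : R) (v : plane R) : plane R :=
  \row_(j < 2) (if j == 0 then cos a * v 0 0 - sin a * v 0 1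
                else sin a * v 0 0 + cos a * v 0 1).

Definition unit_circle (R : realType) (c : plane R) : set (plane R) :=
  [set p | edist p c = 1].

Definition conv_hull (R : realType) (A : set (plane R)) : set (plane R) :=
  smallest (@convex_set R (plane R)) A.

Definition is_lattice (R : realType) (L : set (plane R)) : Prop :=
  exists v1 v2 : plane R, free [:: v1; v2] /\
    L = [set v | exists n1 n2 : int, v = v1 *~ n1 + v2 *~ n2].

Definition rotatable (R : realType) (L : set (plane R)) : Prop :=
  forall a1 a2 : R, 0 <= a1 -> a1 < a2 -> a2 <= pi ->
    exists a lam : R, [/\ a1 < a, a < a2, 0 < lam &
      (fun v => lam *: rotation a v) @` L `<=` L].

(* A bouquet through O is given by the family Z of the centres of its circles;
   its i-th circle is unit_circle (Z i). *)
Definition bouquet (R : realType) (n : nat) (O : plane R)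
    (Z : 'I_n -> plane R) : Prop :=
  (0 < n)%N /\ forall i, unit_circle (Z i) O.

Definition lattice_like (R : realType) (n : nat) (O : plane R)
    (Z : 'I_n -> plane R) : Prop :=
  ~ conv_hull (range Z) O /\
  exists L : set (plane R),
    [/\ is_lattice L, rotatable L & [set O] `|` range Z `<=` L].

Definition proper_colouring (R : realType) (k : nat)
    (phi : plane R -> 'I_k) : Prop :=
  forall p q, edist p q = 1 -> phi p <> phi q.

(* Stated for the circles themselves rather than their centres, so that it
   applies to the image of a bouquet under an isometry. *)
Definition smiling (R : realType) (k n : nat) (phi : plane R -> 'I_k)
    (O : plane R) (C : 'I_n -> set (plane R)) : Prop :=
  exists c : 'I_k, (forall i, exists2 p, C i p & phi p = c) /\ phi O <> c.

(* Main.v *)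
Require Import Defs.
From mathcomp Require Import ring lra zify.

Set Implicit Arguments.
Unset Strict Implicit.
Unset Printing Implicit Defensive.
Import Order.TTheory GRing.Theory Num.Theory.
Import numFieldNormedType.Exports.

Local Open Scope classical_set_scope.
Local Open Scope ring_scope.

(** Let [u_i] be the centres relative to [O]. If there is no smiling copy, then
for every similarity ratio [z] with [0 < |z| <= 2], whenever all the points
[p + z u_i] have colour [c] so has [p]: these points lie on the circles of a
rotated copy of the bouquet through [p]. Gallai's theorem, applied on the fine
dilate [delta L] of the lattice, yields a monochromatic copy of a large disk of
[L]. As [O] is outside the convex hull of the centres, all [u_i] have positive
scalar product with some [w], and since [L] is rotatable, finitely many
similarities preserving [L] turn the [u_i] from any given point towards the
centre of the disk; hence the monochromatic disk grows and fills a whole copy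
of [delta m L]. If [1 / (delta m)] is an integer, this copy contains two points
at unit distance. *)

(** * Gallai's theorem in an abelian group, by colour focusing *)

Definition mono_copy (V : zmodType) (K : Type) (chi : V -> K)
    (T : seq V) (a : V) (d : nat) : Prop :=
  exists c, forall t, t \in T -> chi (a + t *+ d) = c.

(* The base point is confined to a finite set [F] so that, in the induction, the
   colours seen from a point can be packed into a single colour of a finite type. *)
Definition gallai_property (V : zmodType) (T : seq V) : Prop :=
  forall K : finType, exists (F : seq V) (M : nat), forall chi : V -> K,
  exists a d, [/\ a \in F, (0 < d <= M)%N & mono_copy chi T a d].

(* Either [0 :: T] has a monochromatic copy, or [r] copies of [T], of pairwise
   distinct colours, are focused at the same point [f]. *)
Lemma colour_focusing (V : zmodType) (T : seq V) (K : finType) (r : nat) :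
  gallai_property T ->
  exists (F : seq V) (M : nat), forall chi : V -> K,
    (exists a d, [/\ a \in F, (0 < d <= M)%N & mono_copy chi (0 :: T) a d]) \/
    (exists f (s : seq (nat * K)),
       [/\ f \in F, size s = r, uniq (map snd s) &
           forall p, p \in s -> (0 < p.1 <= M)%N /\
             forall t, t \in T -> chi (f + t *+ p.1) = p.2]).
Proof.
move=> galT; case: T galT => [_|t0 T' galT].
  exists [:: 0], 1%N => chi; left; exists 0, 1%N; split; rewrite ?mem_head //.
  by exists (chi 0) => t; rewrite inE => /eqP->; rewrite mul0rn addr0.
set T := t0 :: T' in galT *.
elim: r => [|r [F [M IH]]].
  by exists [:: 0], 0%N => chi; right; exists 0, [::]; rewrite mem_head.
pose offs := F ++ [seq g + p | g <- F, p <- [seq t *+ d | t <- T, d <- iota 1 M]].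
have offsP g d t : g \in F -> (0 < d <= M)%N -> t \in T -> g + t *+ d \in offs.
  move=> gF /andP[d0 dM] tT; rewrite mem_cat; apply/orP; right.
  rewrite allpairs_f //; apply: (allpairs_f (fun t d => t *+ d)) => //.
  by rewrite mem_iota d0 add1n ltnS.
(* Each point is recoloured by the whole pattern of [chi] on its translate of [offs]. A
   monochromatic copy of [T] for these product colours consists of points [x + t *+ d] around which
   [chi] looks the same. *)
have [F1 [M1 H1]] := galT {ffun 'I_(size offs) -> K}.
(* The scales start at 0 so that [G] contains both [x] and [x' = x + t0 *+ d], the base points of
   the two possible outcomes. *)
pose G := [seq x + t0 *+ d | x <- F1, d <- iota 0 M1.+1].
exists [seq y + g | y <- G, g <- F], (M + M1)%N => chi.
have [x [d [xF1 /andP[d0 dM1] [c' Hc']]]] :=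
  H1 (fun x => [ffun i : 'I__ => chi (x + offs`_i)]).
pose x' := x + t0 *+ d.
have shift t o : t \in T -> o \in offs -> chi (x + t *+ d + o) = chi (x' + o).
  move=> tT ofs; have := Hc' t0 (mem_head _ _); rewrite -(Hc' t tT).
  have io : (index o offs < size offs)%N by rewrite index_mem.
  by move=> /ffunP /(_ (Ordinal io)); rewrite !ffunE /= nth_index.
have inF' e g : (e <= M1)%N -> g \in F ->
    x + t0 *+ e + g \in [seq y + g | y <- G, g <- F].
  move=> eM gF; rewrite allpairs_f //.
  by apply: (allpairs_f (fun x d => x + t0 *+ d)); rewrite // mem_iota ltnS.
have [[g [e [gF /andP[e0 eM] [c Hc]]]]|[g [s [gF ss us Hs]]]] := IH (fun y => chi (x' + y)).
  left; exists (x' + g), e; split; first exact: inF'.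
    by rewrite e0 (leq_trans eM) ?leq_addr.
  by exists c => t tT; rewrite -addrA Hc.
(* If the focus [x' + g] has the colour of one of its spokes, it completes that spoke to a copy of
   [0 :: T]. *)
have [/mapP[[e c] ps /= ec]|cs] := boolP (chi (x' + g) \in map snd s).
  have [/andP[/= e0 eM] He] := Hs _ ps.
  left; exists (x' + g), e; split; first exact: inF'.
    by rewrite e0 (leq_trans eM) ?leq_addr.
  exists c => t; rewrite inE => /predU1P[->|tT]; first by rewrite mul0rn addr0.
  by rewrite -addrA He.
(* Otherwise the focus moves to [x + g]. The old spokes get scale [e + d], since the pattern at
   every [x + t *+ d] is that at [x']; the new spoke, of scale [d], has the colour of the old focus,
   which is a new one. *)
right; exists (x + g), ((d, chi (x' + g)) :: [seq (p.1 + d, p.2)%N | p <- s]).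
split.
- by have := inF' 0 g isT gF; rewrite mulr0n addr0.
- by rewrite /= size_map ss.
- by rewrite /= -map_comp (eq_map (g := snd)) ?cs.
move=> p; rewrite inE => /predU1P[->|/mapP[[e c] es ->]] /=.
  split=> [|t tT]; first by rewrite d0 (leq_trans dM1) ?leq_addl.
  by rewrite addrAC shift // mem_cat gF.
have [/andP[/= e0 eM] He] := Hs _ es.
split=> [|t tT]; first by rewrite addn_gt0 e0 leq_add.
by rewrite addnC mulrnDr addrACA shift ?offsP ?e0 // He.
Qed.

(** Shifting the base point by [- u *+ d] compensates for the translation of [T]. *)
Lemma gallai_translate (V : zmodType) (T : seq V) (u : V) :
  gallai_property T -> gallai_property [seq t + u | t <- T].
Proof.
move=> galT K; have [F [M H]] := galT K.
exists [seq a - u *+ d | a <- F, d <- iota 0 M.+1], M => chi.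
have [a [d [aF /andP[d0 dM] [c Hc]]]] := H chi.
exists (a - u *+ d), d; split; last 1 first.
- exists c => _ /mapP[t tT ->].
  by rewrite mulrnDl addrACA addNr addr0 Hc.
- by apply: (allpairs_f (fun a d => a - u *+ d)); rewrite // mem_iota ltnS.
- by rewrite d0.
Qed.

(** Induction on the points, the new one being translated to 0. More than [#|K|] spokes cannot have
    distinct colours, so focusing must end in a monochromatic copy. *)
Theorem gallai (V : zmodType) (T : seq V) : gallai_property T.
Proof.
elim: T => [|t0 T galT] K.
  by exists [:: 0], 1%N => chi; exists 0, 1%N; split; rewrite ?mem_head //; exists (chi 0).
suff /(gallai_translate t0) : gallai_property (0 :: [seq t - t0 | t <- T]).
  rewrite /= add0r -map_comp (eq_map (g := id)) ?map_id; first exact.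
  by move=> t /=; rewrite subrK.
move=> {}K.
have [F [M H]] := colour_focusing K #|K|.+1 (gallai_translate (- t0) galT).
exists F, M => chi; case: (H chi) => // -[f [s [_ ss us _]]].
by have := max_card (mem (map snd s)); rewrite (card_uniqP us) size_map ss ltnn.
Qed.

(** * Convex combinations and separation of a point from a finite hull *)

Lemma convex_setP (R : realType) (M : lmodType R) (B : set M) (t : R) (x y : M) :
  convex_set B -> 0 <= t -> t <= 1 -> B x -> B y -> B (t *: x + (1 - t) *: y).
Proof.
move=> cB t0 t1 /mem_set xB /mem_set yB.
by have /set_mem := cB _ _ (Itv01 t0 t1) xB yB.
Qed.

Lemma convex_set_sum (R : realType) (M : lmodType R) (B : set M)
    (I : Type) (s : seq I) (l : I -> R) (z : I -> M) :
  convex_set B -> (forall i, 0 <= l i) -> (forall i, B (z i)) ->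
  \sum_(i <- s) l i = 1 -> B (\sum_(i <- s) l i *: z i).
Proof.
move=> cB l0 zB.
(* A partial sum need not have weight 1, so the induction normalises it, with total weight 0 as a
   separate case. *)
suff H : (\sum_(i <- s) l i = 0 /\ \sum_(i <- s) l i *: z i = 0) \/
    (0 < \sum_(i <- s) l i /\ B ((\sum_(i <- s) l i)^-1 *: \sum_(i <- s) l i *: z i)).
  case: H => [[-> _ /eqP]|[_ + S1]]; first by rewrite eq_sym oner_eq0.
  by rewrite S1 invr1 scale1r.
elim: s => [|i s IH]; first by left; rewrite !big_nil.
rewrite !big_cons; set S := \sum_(j <- s) l j in IH *.
set X := \sum_(j <- s) _ in IH *.
have := l0 i; rewrite le_eqVlt => /predU1P[<-|li0].
  by rewrite scale0r !add0r.
right; case: IH => [[-> ->]|[S0 BX]].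
  by rewrite !addr0 scalerA mulVf ?gt_eqF // scale1r.
have D0 : 0 < l i + S by rewrite addr_gt0.
split=> //; have := convex_setP cB (t := l i / (l i + S)) _ _ (zB i) BX.
have -> : 1 - l i / (l i + S) = S / (l i + S) by field; rewrite gt_eqF.
have SD : S / (l i + S) * S^-1 = (l i + S)^-1 by field; rewrite !gt_eqF.
rewrite scalerA SD [X in X *: z i]mulrC -scalerA -scalerDr; apply.
- by rewrite divr_ge0 // ltW.
- by rewrite ler_pdivrMr // mul1r lerDl ltW.
Qed.

Lemma continuous_sumr (R : realType) (T : topologicalType) (I : Type) (s : seq I)
    (f : I -> T -> R) :
  (forall i, continuous (f i)) -> continuous (fun x => \sum_(i <- s) f i x).
Proof.
move=> cf; elim: s => [|i s IH] x.
  by under eq_fun do rewrite big_nil; exact: cvg_cst.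
under eq_fun do rewrite big_cons.
by rewrite /continuous_at ?big_cons; apply: cvgD; [exact: cf|exact: IH].
Qed.

Definition dot (R : realType) (u v : plane R) : R := u 0 0 * v 0 0 + u 0 1 * v 0 1.

Lemma dotZr (R : realType) (a : R) (u v : plane R) : dot u (a *: v) = a * dot u v.
Proof. by rewrite /dot !mxE; ring. Qed.

Lemma dotC (R : realType) (u v : plane R) : dot u v = dot v u.
Proof. by rewrite /dot; ring. Qed.

Lemma dot_eq0 (R : realType) (u : plane R) : dot u u = 0 -> u = 0.
Proof.
move=> /eqP; rewrite /dot -!expr2 paddr_eq0 ?sqr_ge0 // !sqrf_eq0.
move=> /andP[/eqP u0 /eqP u1]; apply/rowP => j; rewrite mxE.
by case: j => -[|[|//]] p; [rewrite -[RHS]u0|rewrite -[RHS]u1]; congr (u _ _); apply: val_inj.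
Qed.

Lemma dot_ge0 (R : realType) (u : plane R) : 0 <= dot u u.
Proof. by rewrite /dot -!expr2 addr_ge0 ?sqr_ge0. Qed.

(* The point of least norm of the hull of the [Z i - O] is a suitable [w]. *)
Lemma separation (R : realType) (n : nat) (O : plane R) (Z : 'I_n -> plane R) :
  (0 < n)%N -> ~ conv_hull (range Z) O ->
  exists w : plane R, forall i, 0 < dot w (Z i - O).
Proof.
move=> n0 OZ; pose S := [set l : 'rV[R]_n | (forall i, 0 <= l 0 i) /\ \sum_i l 0 i = 1].
pose X (l : 'rV[R]_n) : plane R := \sum_i l 0 i *: (Z i - O).
pose i0 := Ordinal n0.
have S1 i : S (delta_mx 0 i).
  split=> [j|]; first by rewrite mxE eqxx /=; case: eqP.
  rewrite (bigD1 i) //= mxE !eqxx big1 ?addr0 // => j ji.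
  by rewrite mxE eqxx (negbTE ji).
have cS : compact S.
  apply: bounded_closed_compact.
    exists 1; split=> // M M1 l [l0 l1] /=; rewrite [leLHS]/Num.norm /= mx_normrE.
    apply/bigmax_leP; split=> [|[a i] _] /=; first exact: ltW (lt_trans ltr01 M1).
    rewrite (ord1 a) ger0_norm // (le_trans _ (ltW M1)) // -l1 (bigD1 i) //=.
    by rewrite lerDl sumr_ge0.
  have -> : S = \bigcap_(i in [set: 'I_n]) [set l : 'rV[R]_n | 0 <= l 0 i] `&`
       [set l : 'rV[R]_n | \sum_i l 0 i = 1].
    by apply/seteqP; split=> l /= [h1 h2]; split=> // i; [move=> _; exact: h1|exact: h1].
  apply: closedI.
    apply: closed_bigI => i _.
    exact: (preimage_closed (fun x _ => @coord_continuous R 1 n 0 i x) (@closed_ge R 0)).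
  apply: (@preimage_closed _ _ (fun l : 'rV[R]_n => \sum_i l 0 i) _ _ (@closed_eq R 1)).
  move=> l _; apply: (@continuous_sumr R _ _ _ (fun i (l : 'rV[R]_n) => l 0 i)) => i.
  exact: coord_continuous.
have cX j : continuous (fun l => X l 0 j).
  have -> : (fun l => X l 0 j) = (fun l => \sum_i l 0 i * (Z i - O) 0 j).
    by apply/funext => l; rewrite summxE; apply: eq_bigr => i _; rewrite mxE.
  apply: continuous_sumr => i l;
  have h1 := (@coord_continuous R 1 n 0 i l).
  have h2 : {for l, continuous (fun _ : 'rV[R]_n => (Z i - O) 0 j)} by exact: cst_continuous.
  exact: (continuousM h1 h2).
have cf : continuous (fun l => dot (X l) (X l)).
  move=> l; exact: (continuousD (continuousM (cX 0 l) (cX 0 l))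
    (continuousM (cX 1 l) (cX 1 l))).
have [l /set_mem[l0 l1] lmin] := compact_EVT_min (ex_intro _ _ (S1 i0)) cS
   (continuous_subspaceT cf).
have x0 : 0 < dot (X l) (X l).
  rewrite lt_neqAle dot_ge0 andbT eq_sym; apply/eqP => /dot_eq0 Xl0; apply: OZ.
  move=> B [cB ZB].
  have -> : O = \sum_i l 0 i *: Z i.
    apply/esym/eqP; rewrite -subr_eq0 -[X in _ - X]scale1r -l1 scaler_suml -sumrB.
    by apply/eqP; rewrite -[RHS]Xl0; apply: eq_bigr => i _; rewrite scalerBr.
  by apply: convex_set_sum => // i; apply: ZB; exists i.
exists (X l) => i; apply: (lt_le_trans x0); rewrite leNgt; apply/negP => lt_i.
set v := Z i - O in lt_i.
have XE t : X ((1 - t) *: l + t *: delta_mx 0 i) = (1 - t) *: X l + t *: v.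
  have -> : v = \sum_j (delta_mx 0 i : 'rV[R]_n) 0 j *: (Z j - O).
    rewrite (bigD1 i) //= mxE !eqxx scale1r big1 ?addr0 // => j ji.
    by rewrite mxE eqxx (negbTE ji) scale0r.
  rewrite /X !scaler_sumr -big_split /=; apply: eq_bigr => j _.
  by rewrite !mxE !scalerA -scalerDl.
have St t : 0 <= t -> t <= 1 -> S ((1 - t) *: l + t *: delta_mx 0 i).
  move=> t0 t1; have [d0 d1] := S1 i; split=> [j|].
    by rewrite !mxE addr_ge0 ?mulr_ge0 ?subr_ge0 //; have := d0 j; rewrite mxE.
  rewrite (eq_bigr (fun j => (1 - t) * l 0 j + t * (delta_mx 0 i : 'rV[R]_n) 0 j)).
    by rewrite big_split /= -!mulr_sumr l1 d1; ring.
  by move=> j _; rewrite !mxE.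
set a := dot (X l) (X l) in x0 lt_i lmin; set b := dot (X l) v in lt_i.
pose c := dot v v.
have c0 : 0 <= c := dot_ge0 v.
have cvx t : 0 <= t -> t <= 1 -> a <= (1 - t) ^+ 2 * a + 2 * (1 - t) * t * b + t ^+ 2 * c.
  move=> t0 t1; have := lmin _ (mem_set (St _ t0 t1)); rewrite XE => /le_trans; apply.
  by rewrite le_eqVlt; apply/orP; left; apply/eqP; rewrite /a /b /c /dot !mxE; ring.
pose q := dot (X l - v) (X l - v).
have qE : q = a - 2 * b + c by rewrite /q /a /b /c /dot !mxE; ring.
have q0 : 0 <= q := dot_ge0 _.
have d0 : 0 < a - b + q by lra.
(* On the segment from [X l] to [v] the squared norm is [a - 2 * t * (a - b) + t ^+ 2 * q]. The
   extra [a - b] in the denominator keeps it positive and [t] at most 1, while still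
   [t * q < a - b], so the norm drops below the minimum. *)
pose t := (a - b) / (a - b + q).
have t0 : 0 < t by rewrite divr_gt0 // subr_gt0.
have t1 : t <= 1 by rewrite ler_pdivrMr //; lra.
have tq : t * (a - b + q) = a - b by rewrite divfK ?gt_eqF.
have := cvx t (ltW t0) t1; nra.
Qed.

(** * Similarities as complex multiplications, and smiling copies *)

(* Multiplication of [v], read as a complex number, by [x + i y]. *)
Definition cmul (R : realType) (x y : R) (v : plane R) : plane R :=
  \row_(j < 2) (if j == 0 then x * v 0 0 - y * v 0 1 else y * v 0 0 + x * v 0 1).

Lemma cmulE (R : realType) (x y : R) (v : plane R) :
  (cmul x y v 0 0 = x * v 0 0 - y * v 0 1) * (cmul x y v 0 1 = y * v 0 0 + x * v 0 1).
Proof. by rewrite !mxE. Qed.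

Lemma plane_eqP (R : realType) (u v : plane R) : u 0 0 = v 0 0 -> u 0 1 = v 0 1 -> u = v.
Proof.
move=> e0 e1; apply/rowP => j.
have [->|->] // : j = 0 \/ j = 1.
by case: j => -[|[|//]] p; [left|right]; apply: val_inj.
Qed.

Lemma rotation_cmul (R : realType) (a l : R) (v : plane R) :
  l *: rotation a v = cmul (l * cos a) (l * sin a) v.
Proof. by apply: plane_eqP; rewrite !mxE /=; ring. Qed.

Lemma dot_cmul (R : realType) (x y : R) (u v : plane R) :
  dot (cmul x y u) (cmul x y v) = (x ^+ 2 + y ^+ 2) * dot u v.
Proof. by rewrite /dot !cmulE; ring. Qed.

Lemma edistE (R : realType) (p q : plane R) : edist p q = Num.sqrt (dot (p - q) (p - q)).
Proof.
rewrite /edist !big_ord_recl big_ord0 addr0 /dot !mxE !expr2.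
by have -> : lift ord0 ord0 = 1 :> 'I_2 by exact: val_inj.
Qed.

Lemma edist_eq1 (R : realType) (p q : plane R) : edist p q = 1 <-> dot (p - q) (p - q) = 1.
Proof.
rewrite edistE; split=> [h|->]; last exact: sqrtr1.
by rewrite -[LHS]sqr_sqrtr ?dot_ge0 // h expr1n.
Qed.

(* Write [z = x + i y] as a sum [e + e'] of two unit complex numbers: when the
   bouquet is turned by [e] about [p], the point [p + z u_i] is at distance
   [|e'| = 1] from the centre [p + e u_i]. *)
Lemma smilingN (R : realType) (n k : nat) (O : plane R) (Z : 'I_n -> plane R)
    (phi : plane R -> 'I_k) (p : plane R) (x y : R) (c : 'I_k) :
  (forall i, dot (Z i - O) (Z i - O) = 1) ->
  (forall f, plane_isometry f -> ~ smiling phi (f O) (fun i => f @` unit_circle (Z i))) ->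
  0 < x ^+ 2 + y ^+ 2 <= 4 ->
  (forall i, phi (p + cmul x y (Z i - O)) = c) -> phi p = c.
Proof.
move=> Z1 nosmile /andP[z0 z4] phic.
set r := x ^+ 2 + y ^+ 2 in z0 z4.
(* The two unit summands of [z] are [z (1/2 + i s)] and [z (1/2 - i s)]; [s] is real because
   [r <= 4]. Below, [a + i b] is the first of them. *)
have [s s2] : exists s : R, r * (1 / 4 + s ^+ 2) = 1.
  exists (Num.sqrt (r^-1 - 1 / 4)); rewrite sqr_sqrtr.
    by field; rewrite gt_eqF.
  by rewrite subr_ge0 div1r lef_pV2 ?posrE.
pose a := x / 2 - s * y; pose b := y / 2 + s * x.
have ab1 : a ^+ 2 + b ^+ 2 = 1 by rewrite -s2 /a /b /r; field.
pose f v := p + cmul a b (v - O).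
have f0 : f O = p by apply: plane_eqP; rewrite !mxE /=; ring.
apply: contrapT => phip; apply: (nosmile f).
  move=> u v; rewrite !edistE.
  have -> : f u - f v = cmul a b (u - v) by apply: plane_eqP; rewrite !mxE /=; ring.
  by rewrite dot_cmul ab1 mul1r.
exists c; split=> [i|]; last by rewrite f0.
exists (p + cmul x y (Z i - O)) => //.
(* The preimage under [f]: the inverse of the unit number [a + i b] is its conjugate. *)
exists (O + cmul a (- b) (cmul x y (Z i - O))).
  apply/edist_eq1.
  have -> : O + cmul a (- b) (cmul x y (Z i - O)) - Z i =
     cmul (a * x + b * y - 1) (a * y - b * x) (Z i - O).
    by apply: plane_eqP; rewrite !mxE /=; ring.
  rewrite dot_cmul Z1 mulr1.
  have -> : (a * x + b * y - 1) ^+ 2 + (a * y - b * x) ^+ 2 =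
     (a ^+ 2 + b ^+ 2) * r - 2 * (a * x + b * y) + 1 by rewrite /r; ring.
  by rewrite ab1 /a /b /r; field.
have -> : f (O + cmul a (- b) (cmul x y (Z i - O))) =
    p + cmul ((a ^+ 2 + b ^+ 2) * x) ((a ^+ 2 + b ^+ 2) * y) (Z i - O).
  by apply: plane_eqP; rewrite !mxE /=; ring.
by rewrite ab1 !mul1r.
Qed.

(** * Turning the centres towards the origin by similarities of the lattice *)

Lemma ex_pos_lower_bound (R : realType) (n : nat) (f : 'I_n -> R) :
  (forall i, 0 < f i) -> exists2 m, 0 < m & forall i, m <= f i.
Proof.
move=> f0; exists (\big[Order.min/1]_i f i).
  by elim/big_ind: _ => // a b a0 b0; rewrite lt_min a0.
by move=> i; rewrite (bigD1 i) //= ge_min lexx.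
Qed.

Lemma ex_unit_interval (R : realType) (n : nat) (x : R) :
  0 <= x -> x <= n.+1%:R -> exists j : 'I_n.+1, j%:R <= x <= j.+1%:R.
Proof.
elim: n => [|n IH] x0 xn; first by exists ord0; rewrite x0.
have [xn'|/ltW xn'] := lerP x n.+1%:R; last by exists ord_max; rewrite xn' xn.
by have [j hj] := IH x0 xn'; exists (widen_ord (leqnSn _) j).
Qed.

(** The angle stays in [[0, pi]], the range in which [rotatable] supplies rotations; the lower half
    plane is reached by the sign [s], harmless since a lattice is symmetric. *)
Lemma unit_polar (R : realType) (x y : R) : x ^+ 2 + y ^+ 2 = 1 ->
  exists t s : R, [/\ 0 <= t <= pi, s = 1 \/ s = -1, x = s * cos t & y = s * sin t].
Proof.
wlog y0 : x y / 0 <= y => [H xy|xy].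
  have [y0|/ltW y0] := lerP 0 y; first exact: H.
  have [||t [s [t0 s1 xE yE]]] := H (- x) (- y); rewrite ?sqrrN ?oppr_ge0 //.
  exists t, (- s); split=> //; first by case: s1 => ->; [right|left; rewrite opprK].
    by rewrite mulNr -xE opprK.
  by rewrite mulNr -yE opprK.
have x1 : -1 <= x <= 1 by apply/andP; split; nra.
exists (acos x), 1; split; rewrite ?mul1r ?acos_ge0 ?acos_lepi //; first by left.
  by rewrite acosK.
by rewrite sin_acos // (_ : 1 - x ^+ 2 = y ^+ 2) ?sqrtr_sqr ?ger0_norm //; lra.
Qed.

(** A rotation taking the direction of [w] nearly to that of [- v] gives all [u i] a negative
    product with [v]. Finitely many similarities, one for each short interval of angles, serve all
    [v], so [eta] and [hi] are uniform. *)
Lemma rotate_towards (R : realType) (n : nat) (L : set (plane R)) (u : 'I_n -> plane R)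
    (w : plane R) :
  rotatable L -> (forall l, L l -> L (- l)) -> (forall i, 0 < dot w (u i)) ->
  (forall i, dot (u i) (u i) = 1) -> (0 < n)%N ->
  exists eta hi : R, [/\ 0 < eta, 0 < hi & forall v : plane R, exists x y : R,
    [/\ 0 < x ^+ 2 + y ^+ 2 <= hi, forall l, L l -> L (cmul x y l) &
        forall i, dot v (cmul x y (u i)) <= - eta * Num.sqrt (dot v v)]].
Proof.
move=> rotL negL wu u1 n0.
have [c c0 cw] := ex_pos_lower_bound wu.
pose r := Num.sqrt (dot w w).
have ww0 : 0 < dot w w.
  rewrite lt_neqAle dot_ge0 andbT eq_sym; apply/eqP => /dot_eq0 w0.
  by have := wu (Ordinal n0); rewrite w0 /dot !mxE !mul0r addr0 ltxx.
have r0 : 0 < r by rewrite sqrtr_gt0.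
have r2 : r ^+ 2 = dot w w by rewrite sqr_sqrtr ?ltW.
(* [e] is an angular tolerance: turning [u i] by less than [e] keeps its product with [w] above
   [c / 2]. *)
have [e /= e0 He] : \forall d \near (0 : R), c / 2 < cos d * c - `|sin d| * r.
  have H : cos d * c - `|sin d| * r @[d --> (0 : R)] --> cos 0 * c - `|sin 0| * r.
    apply: cvgB; apply: cvgM; [exact: continuous_cos|exact: cvg_cst| |exact: cvg_cst].
    by apply: cvg_norm; exact: continuous_sin.
  apply: (cvgr_gt _ H); rewrite cos0 sin0 normr0; lra.
have Hd d i : `|d| < e -> c / 2 < dot w (cmul (cos d) (sin d) (u i)).
  move=> de; have := He d; rewrite /= sub0r normrN => /(_ de).
  have -> : dot w (cmul (cos d) (sin d) (u i)) = cos d * dot w (u i) +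
      sin d * (w 0 1 * u i 0 0 - w 0 0 * u i 0 1) by rewrite /dot !cmulE; ring.
  set X := (w 0 1 * _ - _) => hd.
  (* Up to sign, [X] is the determinant of [w] and [u i], so Lagrange's identity bounds it. *)
  have X2 : X ^+ 2 <= r ^+ 2.
    rewrite r2 -[leRHS]mulr1 -(u1 i) -subr_ge0.
    have -> : dot w w * dot (u i) (u i) - X ^+ 2 = dot w (u i) ^+ 2 by rewrite /X /dot; ring.
    exact: sqr_ge0.
  have Xr : `|X| <= r by rewrite -ler_sqr ?nnegrE ?(ltW r0) // real_normK ?num_real.
  have cosd : 0 < cos d.
    rewrite -(pmulr_lgt0 _ c0); apply: (@lt_trans _ _ (c / 2)); first by rewrite divr_gt0.
    by apply: (lt_le_trans hd); rewrite gerBl mulr_ge0 // ltW.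
  apply: (lt_le_trans hd); apply: lerD; first by rewrite ler_pM2l.
  by rewrite lerNl (le_trans (ler_norm _)) // normrN normrM ler_wpM2l.
have [N HN] : exists N : nat, pi / N.+1%:R < e.
  exists (Num.truncn (pi / e)); rewrite ltr_pdivrMr ?ltr0n // mulrC -ltr_pdivrMr //.
  exact: truncnS_gt.
have rotj (j : 'I_N.+1) : exists al : R * R,
    [/\ pi * j%:R / N.+1%:R < al.1, al.1 < pi * j.+1%:R / N.+1%:R, 0 < al.2 &
     forall l, L l -> L (cmul (al.2 * cos al.1) (al.2 * sin al.1) l)].
  have [||| a [lam [h1 h2 h3 h4]]] := rotL (pi * j%:R / N.+1%:R) (pi * j.+1%:R / N.+1%:R).
  - by rewrite divr_ge0 ?mulr_ge0 ?pi_ge0.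
  - by rewrite ltr_pM2r ?invr_gt0 ?ltr0n // ltr_pM2l ?pi_gt0 // ltr_nat.
  - by rewrite ler_pdivrMr ?ltr0n // ler_pM2l ?pi_gt0 // ler_nat ltn_ord.
  exists (a, lam); split=> //= l Ll; rewrite -rotation_cmul; apply: h4.
  by exists l.
have {rotj} [al Hal] := choice rotj.
have [m m0 Hm] : exists2 m, 0 < m & forall j, m <= (al j).2.
  by apply: ex_pos_lower_bound => j; case: (Hal j).
(* [m] bounds all scales from below, [c / 2] survives the angular error, and [r] is the norm of [w];
   the sum bounds every squared scale. *)
exists (m * c / 2 / r), (\sum_j (al j).2 ^+ 2).
have sq_le j : (al j).2 ^+ 2 <= \sum_j (al j).2 ^+ 2.
  by rewrite (bigD1 j) //= lerDl sumr_ge0 // => k _; exact: sqr_ge0.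
have al0 j : 0 < (al j).2 by case: (Hal j).
split=> [| |v].
- by rewrite !mulr_gt0 ?invr_gt0.
- by apply: lt_le_trans (sq_le ord0); rewrite exprn_gt0.
pose V := Num.sqrt (dot v v).
have V2 : V ^+ 2 = dot v v by rewrite sqr_sqrtr ?dot_ge0.
have V0 : 0 <= V := sqrtr_ge0 _.
(* [x + i y] is the quotient of the directions of [- v] and [w] *)
have [x [y [xy1 vE]]] : exists x y : R, x ^+ 2 + y ^+ 2 = 1 /\ r *: v = - V *: cmul x y w.
  have [v0|v0] := eqVneq V 0.
    exists 1, 0; split; first by rewrite expr1n expr0n addr0.
    have -> : v = 0 by apply: dot_eq0; rewrite -V2 v0 expr0n.
    by rewrite v0 oppr0 scale0r scaler0.
  have r0' := lt0r_neq0 r0.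
  exists (- dot w v / (r * V)), (- (w 0 0 * v 0 1 - w 0 1 * v 0 0) / (r * V)); split.
    rewrite !expr_div_n -mulrDl.
    have -> : (- dot w v) ^+ 2 + (- (w 0 0 * v 0 1 - w 0 1 * v 0 0)) ^+ 2 = (r * V) ^+ 2.
      by rewrite exprMn r2 V2 /dot; ring.
    by rewrite divff // sqrf_eq0 mulf_neq0.
  have ww : r * r = dot w w by rewrite -r2 expr2.
  by apply: plane_eqP; rewrite !mxE /=; apply: (mulfI r0'); rewrite mulrA ww /dot; field; rewrite v0 r0'.
have [t [s [/andP[t0 tpi] s1 xE yE]]] := unit_polar xy1.
have [j /andP[j1 j2]] : exists j : 'I_N.+1, j%:R <= t * N.+1%:R / pi <= j.+1%:R.
  apply: ex_unit_interval; first by rewrite !(mulr_ge0, invr_ge0) ?pi_ge0.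
  by rewrite ler_pdivrMr ?pi_gt0 // mulrC ler_pM2l // ltr0n.
have [h1 h2 _ h4] := Hal j; have := al0 j; have := Hm j; have := sq_le j.
move: (al j) h1 h2 h4 => [a lam] /= h1 h2 h4 lamhi mlam lam0.
have s2 : s ^+ 2 = 1 by case: s1 => ->; rewrite ?sqrrN expr1n.
exists (s * (lam * cos a)), (s * (lam * sin a)); split.
- by rewrite !exprMn s2 !mul1r -mulrDr cos2Dsin2 mulr1 lamhi exprn_gt0.
- move=> l Ll; case: s1 => ->; first by rewrite !mul1r; exact: h4.
  have -> : cmul (-1 * (lam * cos a)) (-1 * (lam * sin a)) l = - cmul (lam * cos a) (lam * sin a) l.
    by apply: plane_eqP; rewrite !mxE /=; ring.
  exact/negL/h4.
move=> i; rewrite -/V -(ler_pM2l r0).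
have -> : r * dot v (cmul (s * (lam * cos a)) (s * (lam * sin a)) (u i)) =
    dot (r *: v) (cmul (s * (lam * cos a)) (s * (lam * sin a)) (u i)).
  by rewrite [RHS]dotC dotZr dotC.
rewrite vE xE yE.
have -> : dot (- V *: cmul (s * cos t) (s * sin t) w)
    (cmul (s * (lam * cos a)) (s * (lam * sin a)) (u i)) =
   - s ^+ 2 * (V * lam * dot w (cmul (cos (a - t)) (sin (a - t)) (u i))).
  by rewrite cosB sinB /dot !(cmulE, mxE); ring.
have -> : r * (- (m * c / 2 / r) * V) = - (V * m * (c / 2)) by field; rewrite gt_eqF.
rewrite s2 mulN1r lerN2 -!mulrA ler_wpM2l //.
(* [a] and [t] lie in the same interval of length [pi / N.+1%:R], which is less than [e]. *)
have /ltW Hat : c / 2 < dot w (cmul (cos (a - t)) (sin (a - t)) (u i)).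
  apply: Hd; apply: lt_trans HN.
  have N0 : 0 < N.+1%:R :> R by rewrite ltr0n.
  have lo : pi * j%:R / N.+1%:R <= t.
    by rewrite ler_pdivrMr // mulrC -ler_pdivlMr ?pi_gt0.
  have up : t <= pi * j.+1%:R / N.+1%:R.
    by rewrite ler_pdivlMr // [leRHS]mulrC -ler_pdivrMr ?pi_gt0.
  have : pi * j.+1%:R / N.+1%:R = pi * j%:R / N.+1%:R + pi / N.+1%:R :> R.
    by rewrite -natr1; ring.
  move=> E; move: h1 h2 lo up; rewrite E.
  move: (pi * j%:R / N.+1%:R) (pi / N.+1%:R) => A B h1 h2 lo up.
  by rewrite ltr_norml; apply/andP; split; lra.
by apply: ler_pM => //; rewrite ltW // divr_gt0.
Qed.

(** * Lattices: group structure and finiteness in disks *)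

Lemma lattice0 (R : realType) (L : set (plane R)) : is_lattice L -> L 0.
Proof. by move=> [v1 [v2 [_ ->]]]; exists 0, 0; rewrite !mulr0z addr0. Qed.

Lemma latticeN (R : realType) (L : set (plane R)) (l : plane R) :
  is_lattice L -> L l -> L (- l).
Proof.
move=> [v1 [v2 [_ ->]]] [a [b ->]]; exists (- a), (- b).
by rewrite !mulrNz opprD.
Qed.

Lemma latticeD (R : realType) (L : set (plane R)) (l m : plane R) :
  is_lattice L -> L l -> L m -> L (l + m).
Proof.
move=> [v1 [v2 [_ ->]]] [a [b ->]] [c [d ->]]; exists (a + c), (b + d).
by rewrite !mulrzDr addrACA.
Qed.

Lemma latticeMn (R : realType) (L : set (plane R)) (l : plane R) (n : nat) :
  is_lattice L -> L l -> L (l *+ n).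
Proof.
move=> latL Ll; elim: n => [|n IH]; first by rewrite mulr0n; exact: lattice0.
by rewrite mulrS; exact: latticeD.
Qed.

Definition cross (R : realType) (u v : plane R) : R := u 0 0 * v 0 1 - u 0 1 * v 0 0.

Lemma cross_sq_le (R : realType) (u v : plane R) :
  cross u v ^+ 2 <= dot u u * dot v v.
Proof.
rewrite -subr_ge0.
have -> : dot u u * dot v v - cross u v ^+ 2 = dot u v ^+ 2 by rewrite /cross /dot; ring.
exact: sqr_ge0.
Qed.

Lemma free_cross (R : realType) (v1 v2 : plane R) : free [:: v1; v2] -> cross v1 v2 != 0.
Proof.
rewrite free_cons seq1_free => /andP[v12 v20]; apply: contra v12 => /eqP v0.
rewrite span_seq1; apply/vlineP; exists (dot v1 v2 / dot v2 v2).
have d0 : dot v2 v2 != 0 by apply: contra v20 => /eqP /dot_eq0 ->.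
apply: plane_eqP; rewrite mxE; apply: (mulfI d0); rewrite mulrA [_ * (_ / _)]mulrCA divff // mulr1.
  apply/eqP; rewrite -subr_eq0.
  have -> : dot v2 v2 * v1 0 0 - dot v1 v2 * v2 0 0 = cross v1 v2 * v2 0 1.
    by rewrite /dot /cross; ring.
  by rewrite v0 mul0r.
apply/eqP; rewrite -subr_eq0.
have -> : dot v2 v2 * v1 0 1 - dot v1 v2 * v2 0 1 = - cross v1 v2 * v2 0 0.
  by rewrite /dot /cross; ring.
by rewrite v0 oppr0 mul0r.
Qed.

(** By Cramer's rule the coordinates of [l], multiplied by [D], are determinants of [l] with a basis
    vector, hence bounded in terms of the norm of [l]. *)
Lemma lattice_disk_finite (R : realType) (L : set (plane R)) (r : R) :
  is_lattice L -> exists T : seq (plane R), forall l, L l -> dot l l <= r -> l \in T.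
Proof.
move=> [v1 [v2 [/free_cross D0 ->]]].
set D := cross v1 v2 in D0.
have D2 : 0 < D ^+ 2 by rewrite exprn_even_gt0.
have [B HB] : exists B : nat, r * (dot v1 v1 + dot v2 v2) / D ^+ 2 <= B%:R.
  by exists (Num.truncn (r * (dot v1 v1 + dot v2 v2) / D ^+ 2)).+1; rewrite ltW // truncnS_gt.
pose Is : seq int := [seq k%:Z - B%:Z | k <- iota 0 (B + B).+1].
have inIs (n : int) : (n%:~R * D) ^+ 2 <= r * (dot v1 v1 + dot v2 v2) -> n \in Is.
  move=> nD.
  have : (n ^+ 2)%:~R <= B%:Z%:~R :> R.
    rewrite -[leRHS]/(B%:R) (le_trans _ HB) // ler_pdivlMr // rmorphXn /= -exprMn //.
  rewrite ler_int => nB.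
  (* An integer satisfies [|n| <= n ^ 2], so the bound on the square serves for [n] itself. *)
  have [n1 n2] : - B%:Z <= n /\ n <= B%:Z by rewrite expr2 in nB; split; nia.
  by apply/mapP; exists (absz (n + B%:Z)); [rewrite mem_iota|]; lia.
exists [seq v1 *~ a + v2 *~ b | a <- Is, b <- Is] => _ [a [b ->]] lr.
set l := _ + _ in lr *.
have r0 : 0 <= r := le_trans (dot_ge0 l) lr.
have l0 j : l 0 j = a%:~R * v1 0 j + b%:~R * v2 0 j.
  by rewrite /l -(scaler_int a v1) -(scaler_int b v2) !mxE.
apply: (allpairs_f (fun a b => v1 *~ a + v2 *~ b)); apply: inIs.
  have -> : a%:~R * D = cross l v2 by rewrite /cross !l0 /D /cross; ring.
  apply: le_trans (cross_sq_le _ _) _; rewrite ler_pM ?dot_ge0 //.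
  by rewrite lerDr dot_ge0.
have -> : b%:~R * D = cross v1 l by rewrite /cross !l0 /D /cross; ring.
apply: le_trans (cross_sq_le _ _) _; rewrite mulrC ler_pM ?dot_ge0 //.
by rewrite lerDl dot_ge0.
Qed.

(** * Growth of a monochromatic disk and the unit segment in it *)

(* A point [l] just outside a monochromatic disk about the origin gets its colour:
   by the choice of the rotation, all the [l + z u_i] are closer to the origin. *)
Lemma mono_spreads (R : realType) (K : Type) (n : nat) (L : set (plane R))
    (u : 'I_n -> plane R) (eta hi : R) (G : plane R -> K) (c : K) :
  is_lattice L -> (forall i, L (u i)) -> (forall i, dot (u i) (u i) = 1) ->
  0 < eta -> 0 < hi ->
  (forall v : plane R, exists x y : R,
    [/\ 0 < x ^+ 2 + y ^+ 2 <= hi, forall l, L l -> L (cmul x y l) &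
        forall i, dot v (cmul x y (u i)) <= - eta * Num.sqrt (dot v v)]) ->
  (forall p x y, 0 < x ^+ 2 + y ^+ 2 <= hi ->
     (forall i, G (p + cmul x y (u i)) = c) -> G p = c) ->
  (forall l, L l -> dot l l <= (hi / eta) ^+ 2 -> G l = c) ->
  forall l, L l -> G l = c.
Proof.
move=> latL Lu u1 eta0 hi0 dir NA base l Ll.
(* Induction on the squared norm in units of [hi]: when [eta * Num.sqrt (dot l l) >= hi], passing to
   [l + z u_i] changes it by at most [- 2 * hi + hi = - hi]. *)
have [m] : exists m : nat, dot l l <= m%:R * hi.
  exists (Num.truncn (dot l l / hi)).+1.
  by rewrite -ler_pdivrMr // ltW // truncnS_gt.
elim: m l Ll => [|m IH] l Ll lm.
  by apply: base => //; apply: le_trans lm _; rewrite mul0r sqr_ge0.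
have [lb|/ltW lb] := lerP (dot l l) ((hi / eta) ^+ 2); first exact: base.
have [x [y [xyhi Lxy dl]]] := dir l.
apply: (NA _ _ _ xyhi) => i; apply: IH; first by apply: latticeD => //; exact: Lxy.
have {}dl := dl i; set s := Num.sqrt (dot l l) in dl.
have hs : hi <= eta * s.
  rewrite mulrC -ler_pdivrMr // -[leLHS]ger0_norm; last by rewrite ltW ?divr_gt0.
  by rewrite -sqrtr_sqr ler_wsqrtr.
have -> : dot (l + cmul x y (u i)) (l + cmul x y (u i)) =
    dot l l + 2 * dot l (cmul x y (u i)) + dot (cmul x y (u i)) (cmul x y (u i)).
  by rewrite /dot !mxE; ring.
rewrite dot_cmul u1 mulr1; move: lm; rewrite -natr1; move/andP: xyhi => [_ xyhi].
move: (x ^+ 2 + y ^+ 2) xyhi => X xyhi lm; lra.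
Qed.

Theorem theorem5p3 (R : realType) (n : nat) (O : plane R)
    (Z : 'I_n -> plane R) :
  bouquet O Z -> lattice_like O Z ->
  forall (k : nat) (phi : plane R -> 'I_k), proper_colouring phi ->
  exists f : plane R -> plane R,
    plane_isometry f /\ smiling phi (f O) (fun i => f @` unit_circle (Z i)).
Proof.
move=> [n0 OZ] [hull [L [latL rotL OZL]]] k phi proper; apply: contrapT => nosmile.
pose u i := Z i - O.
have u1 i : dot (u i) (u i) = 1.
  have /edist_eq1 <- := OZ i; rewrite /u /dot !mxE; ring.
have Lu i : L (u i).
  apply: latticeD => //; first by apply: OZL; right; exists i.
  by apply: latticeN => //; apply: OZL; left.
have [w wu] := separation n0 hull.
have [eta [hi [eta0 hi0 dir]]] := rotate_towards rotL (fun l => latticeN latL) wu u1 n0.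
have [T HT] := lattice_disk_finite ((hi / eta) ^+ 2) latL.
have [F [M HM]] := gallai T 'I_k.
(* The factor [K >= hi] makes the final scale [s = 1 / (q K)] so small that [s ^+ 2 * hi <= 4], as
   [smilingN] requires of the ratios [s z]. *)
pose K := (Num.truncn hi).+1.
have hiK : hi <= K%:R by rewrite ltW // truncnS_gt.
pose delta : R := (M`! * K)%:R^-1.
have [a [m [_ /andP[m0 mM] [c Hc]]]] := HM (fun x => phi (delta *: x)).
(* With this [delta], any admissible Gallai scale [m] makes [1 / (delta m)] an
   integer, so that the monochromatic lattice contains a unit segment. *)
pose q := (M`! %/ m)%N.
have qE : (q * m = M`!)%N by rewrite divnK // dvdn_fact // m0.
have q0 : (0 < q)%N by rewrite -(ltn_pmul2r m0) mul0n qE fact_gt0.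
pose s : R := delta *+ m.
have K0 : 0 < K%:R :> R by rewrite ltr0n.
have q0' : 0 < q%:R :> R by rewrite ltr0n.
have sE : s = (q * K)%:R^-1.
  rewrite /s /delta -mulr_natr -qE !natrM; field.
  by rewrite !pnatr_eq0 -!lt0n m0 q0.
have mono l : L l -> phi (delta *: a + s *: l) = c.
  apply: (@mono_spreads R _ n L u eta hi (fun l => phi (delta *: a + s *: l))) => //.
    move=> p x y /andP[xy0 xyhi] Hp.
    apply: (@smilingN R n k O Z phi _ (s * x) (s * y) c) => //.
    - by move=> f isof smf; apply: nosmile; exists f.
    - rewrite !exprMn -mulrDr; apply/andP; split.
        by rewrite mulr_gt0 // exprn_gt0 // sE invr_gt0 natrM mulr_gt0.
      rewrite sE exprVn mulrC ler_pdivrMr ?exprn_gt0 ?natrM ?mulr_gt0 //.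
      have q1 : 1 <= q%:R :> R by rewrite ler1n.
      have K1 : 1 <= K%:R :> R by rewrite ler1n.
      apply: le_trans xyhi (le_trans hiK _).
      have KQ : K%:R <= q%:R * K%:R :> R by rewrite ler_peMl // ltW.
      by move: (q%:R * K%:R) KQ => Q KQ; nra.
    move=> i; rewrite -(Hp i); congr (phi _).
    by apply: plane_eqP; rewrite !mxE /=; ring.
  move=> {}l Ll lr; rewrite -(Hc l); last exact: HT.
  by rewrite scalerDr -scalerMnr /s -scalerMnl.
pose i0 := Ordinal n0.
(* Since [s * (q * K) = 1], the unit vector [u i0] is [s] times the lattice vector
   [u i0 *+ (q * K)]. *)
apply: (proper (delta *: a + u i0) (delta *: a)).
  by apply/edist_eq1; rewrite addrAC subrr add0r.
have := mono _ (lattice0 latL); rewrite scaler0 addr0 => ->.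
rewrite -(mono (u i0 *+ (q * K))); last exact: latticeMn.
by rewrite -scaler_nat scalerA sE mulVf ?scale1r // pnatr_eq0 muln_eq0 negb_or -!lt0n q0.
Qed.
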